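(* Let $E$ be a symmetric operator defined on a dense domain $\mathcal D$ of a Hilbert space $\mathcal H$. Let $\mathbf d=\{d_i\}_{i\in\mathbb N}$ and $\boldsymbol\lambda=\{\lambda_i\}_{i\in\mathbb N}$ be nondecreasing unbounded real sequences such that \[ \delta_k:=\sum_{i=1}^k(d_i-\lambda_i)\ge0\qquad\text{for all }k\in\mathbb N. \] Assume that $\delta_k<\alpha:=\liminf_{i\to\infty}\delta_i$ for infinitely many $k$. If $\{f_i\}_{i\in\mathbb N}\subset\mathcal D$ is an orthonormal sequence with $\langle Ef_i,f_i\rangle=\lambda_i$ for all $i$, then there exists an orthonormal sequence $\{e_i\}_{i\in\mathbb N}$, each element of which lies in the (algebraic) linear span of $\{f_i\}_{i\in\mathbb N}$, such that $\overline{\operatorname{span}}\{e_i\}=\overline{\operatorname{span}}\{f_i\}$ and $\langle Ee_i,e_i\rangle=d_i$ for all $i\in\mathbb N$.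
   Context: $E$ symmetric means $\langle Ef,g\rangle=\langle f,Eg\rangle$ for all $f,g\in\mathcal D$. $\overline{\operatorname{span}}$ is the closed linear span. *)

(* Defs.v *)
From HB Require Import structures.
From mathcomp Require Import all_boot all_order all_algebra.
From mathcomp Require Import complex.
From mathcomp Require Import all_classical all_reals.
From mathcomp Require Import ereal sequences.
Set Implicit Arguments. Unset Strict Implicit. Unset Printing Implicit Defensive.
Import Order.TTheory GRing.Theory Num.Theory.
Local Open Scope ring_scope.
Local Open Scope classical_set_scope.

Section Hilbert.
Variable R : realType.
Variable V : lmodType R[i].
(* ip x y: linear in x, conjugate-linear in y *)
Variable ip : V -> V -> R[i].

Definition is_inner_product : Prop :=
  [/\ (forall (a : R[i]) (x y z : V), ip (a *: x + y) z = a * ip x z + ip y z),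
      (forall x y : V, ip y x = conjc (ip x y)),
      (forall x : V, 0 <= complex.Re (ip x x)) &
      (forall x : V, complex.Re (ip x x) = 0 -> x = 0)].

Definition hnorm (x : V) : R := Num.sqrt (complex.Re (ip x x)).

Definition ip_complete : Prop :=
  forall u : nat -> V,
    (forall e : R, 0 < e -> exists N : nat, forall m n : nat,
        (N <= m)%N -> (N <= n)%N -> hnorm (u m - u n) < e) ->
    exists l : V, forall e : R, 0 < e -> exists N : nat, forall n : nat,
        (N <= n)%N -> hnorm (u n - l) < e.

Definition is_hilbert : Prop := is_inner_product /\ ip_complete.

Definition hclosure (A : set V) : set V :=
  [set x | forall e : R, 0 < e -> exists y, A y /\ hnorm (x - y) < e].

Definition hdense (A : set V) : Prop := forall x, hclosure A x.

Definition is_subspace (D : set V) : Prop :=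
  D 0 /\ forall (a : R[i]) (x y : V), D x -> D y -> D (a *: x + y).

Definition lspan (f : nat -> V) : set V :=
  [set x | exists (n : nat) (c : nat -> R[i]), x = \sum_(j < n) c j *: f j].

Definition cspan (f : nat -> V) : set V := hclosure (lspan f).

Definition horthonormal (f : nat -> V) : Prop :=
  forall i j : nat, ip (f i) (f j) = (i == j)%:R.

(* E : D -> V linear operator with domain D (given as a total function,
   only its values on D matter) which is symmetric *)
Definition hsymmetric_op (D : set V) (E : V -> V) : Prop :=
  (forall (a : R[i]) (x y : V), D x -> D y -> E (a *: x + y) = a *: E x + E y) /\
  (forall f g : V, D f -> D g -> ip (E f) g = ip f (E g)).

End Hilbert.

Definition nondecr_seq (R : realType) (u : nat -> R) : Prop :=
  forall i j : nat, (i <= j)%N -> u i <= u j.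

Definition unbounded_seq (R : realType) (u : nat -> R) : Prop :=
  forall M : R, exists i : nat, M < u i.

(* delta k = sum_{i=1}^{k+1} (d_i - lambda_i)  (0-based indexing: the paper's
   index i corresponds to i-1 here) *)
Definition delta (R : realType) (d lam : nat -> R) (k : nat) : R :=
  \sum_(i < k.+1) (d i - lam i).

(* Main.v *)
(* Rotating two orthonormal vectors x and y, with the phase chosen so that the
   cross term of the quadratic form vanishes, moves any amount
   r <= <E y, y> - <E x, x> from the diagonal value of y to that of x. For
   finitely many vectors, iterating such transfers gives the Schur-Horn theorem,
   each transfer setting at least one diagonal value to its target.

   In the infinite problem the amount S n := sum_(i < n) (d i - lambda i) that
   is missing in the first n values has to be brought in from infinity. Since
   delta lies infinitely often below its liminf, it has a minimum on every tail,
   so there are pivots k 0 < k 1 < ... such that S never drops below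
   S (k m).+1 after k m. Stage m transfers S (k m).+1 from the vector at k m.+1
   to the vector at k m; the vectors up to k m that are not yet settled then
   satisfy the hypotheses of the finite theorem. As lambda is unbounded, the
   pivots can be taken so far apart that the new pivot vector enters the old one
   with a coefficient of at most 1/sqrt 2. Hence the pivot vectors lie in the
   closed span of the settled ones, and no dimension is lost in the limit. *)
Require Import Defs.
From mathcomp Require Import all_boot all_order all_algebra.
From mathcomp Require Import complex.
From mathcomp Require Import all_classical all_reals.
From mathcomp Require Import ereal sequences normedtype.
From mathcomp Require Import zify ring lra.
Import Order.TTheory GRing.Theory Num.Theory.
Import Normc.
Local Open Scope complex_scope.
Local Open Scope ring_scope.
Local Open Scope classical_set_scope.

Set Implicit Arguments.
Unset Strict Implicit.
Unset Printing Implicit Defensive.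

Section LinearSpan.
Variables (R : realType) (V : lmodType R[i]).
Implicit Types (W S T : set V) (A B : set nat) (f F G H : nat -> V) (x y : V).

Lemma subspaceD W x y : is_subspace W -> W x -> W y -> W (x + y).
Proof. by case=> _ W_lin Wx Wy; rewrite -[x]scale1r; exact: W_lin. Qed.

Lemma subspaceZ W (a : R[i]) x : is_subspace W -> W x -> W (a *: x).
Proof. by case=> W0 W_lin Wx; rewrite -[_ *: _]addr0; exact: W_lin. Qed.

Definition linspan S : set V :=
  [set x | forall W, is_subspace W -> S `<=` W -> W x].

Lemma linspan_subspace S : is_subspace (linspan S).
Proof.
split=> [W [W0 _] _ //|a x y Sx Sy W subW SW].
by case: (subW) => _; apply; [exact: Sx|exact: Sy].
Qed.

Lemma sub_linspan S : S `<=` linspan S.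
Proof. by move=> x Sx W _; apply. Qed.

Lemma linspan_sub S W : is_subspace W -> S `<=` W -> linspan S `<=` W.
Proof. by move=> subW SW x; apply. Qed.

Lemma linspanS S T : S `<=` T -> linspan S `<=` linspan T.
Proof.
move=> ST; apply: linspan_sub; first exact: linspan_subspace.
exact: subset_trans ST (@sub_linspan T).
Qed.

Lemma mem_linspan_image A F i : A i -> linspan (F @` A) (F i).
Proof. by move=> Ai; apply: sub_linspan; exists i. Qed.

Lemma lspan_subspace f : is_subspace (lspan f).
Proof.
split; first by exists 0%N, (fun=> 0); rewrite big_ord0.
move=> a x y [m [b ->]] [n [c ->]].
have pad p (g : nat -> R[i]) : (p <= m + n)%N ->
    \sum_(j < p) g j *: f j =
    \sum_(j < m + n) (if (j < p)%N then g j else 0) *: f j.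
  move=> pmn; rewrite (big_ord_widen _ (fun j => g j *: f j) pmn) big_mkcond /=.
  by apply: eq_bigr => j _; case: ifP => // _; rewrite scale0r.
exists (m + n)%N, (fun j => a * (if (j < m)%N then b j else 0) +
                            (if (j < n)%N then c j else 0)).
rewrite (pad m) ?leq_addr// (pad n) ?leq_addl// scaler_sumr -big_split /=.
by apply: eq_bigr => j _; rewrite scalerDl scalerA.
Qed.

Lemma mem_lspan f i : lspan f (f i).
Proof.
exists i.+1, (fun j => (j == i)%:R); rewrite big_ord_recr /= eqxx scale1r.
rewrite big1 ?add0r// => j _.
by rewrite (ltn_eqF (ltn_ord j)) scale0r.
Qed.

Lemma lspanE f : lspan f = linspan (range f).
Proof.
apply/seteqP; split.
  move=> _ [n [c ->]] W subW fW; elim/big_ind: _ => [|x y|j _].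
  - by case: subW.
  - exact: subspaceD.
  - by apply: subspaceZ => //; apply: fW; exists (val j).
apply: linspan_sub; first exact: lspan_subspace.
by move=> _ [i _ <-]; exact: mem_lspan.
Qed.

Definition recombines A F G : Prop :=
  (forall i, ~ A i -> G i = F i) /\ linspan (G @` A) = linspan (F @` A).

Lemma recombines_refl A F : recombines A F F.
Proof. by []. Qed.

Lemma recombines_sym A F G : recombines A F G -> recombines A G F.
Proof. by move=> [offA spanA]; split=> // i /offA. Qed.

Lemma recombines_trans A F G H :
  recombines A F G -> recombines A G H -> recombines A F H.
Proof.
move=> [FG spanFG] [GH spanGH]; split=> [i Ai|]; last by rewrite spanGH.
by rewrite GH ?FG.
Qed.

Lemma recombinesS A B F G :
  A `<=` B -> recombines A F G -> recombines B F G.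
Proof.
move=> AB FG; split=> [i Bi|]; first by case: FG => + _; apply=> /AB.
suff span_sub F' G' : recombines A F' G' ->
    linspan (G' @` B) `<=` linspan (F' @` B).
  by apply/seteqP; split; apply: span_sub => //; exact: recombines_sym.
move=> [offA spanA]; apply: linspan_sub; first exact: linspan_subspace.
move=> _ [i Bi <-]; have [Ai|nAi] := pselect (A i); last first.
  by rewrite offA //; exact: mem_linspan_image.
have : linspan (F' @` A) (G' i) by rewrite -spanA; exact: mem_linspan_image.
by apply: linspanS; exact: image_subset.
Qed.

End LinearSpan.

Section ComplexConjugation.
Variable R : rcfType.
Implicit Types z : R[i].

Lemma mulCJ z : z * z^* = (normc z ^+ 2)%:C.
Proof. by rewrite -normCK normc_def -rmorphXn; case: z. Qed.

Lemma conj_realC (x : R) : (x%:C)^* = x%:C.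
Proof. exact: conjc_real. Qed.

End ComplexConjugation.

Section InnerProduct.
Variables (R : realType) (V : lmodType R[i]) (ip : V -> V -> R[i]).
Hypothesis ip_inner : is_inner_product ip.
Implicit Types (W A B : set V) (x y z : V).

Lemma ip_conj x y : ip y x = (ip x y)^*.
Proof. by case: ip_inner. Qed.

Lemma ipDl x y z : ip (x + y) z = ip x z + ip y z.
Proof.
by case: ip_inner => ip_lin _ _ _; rewrite -{1}[x]scale1r ip_lin mul1r.
Qed.

Lemma ip0l z : ip 0 z = 0.
Proof. by have := ipDl 0 0 z; rewrite addr0 -{1}[ip _ _]addr0 => /addrI. Qed.

Lemma ipZl a x z : ip (a *: x) z = a * ip x z.
Proof.
by case: ip_inner => ip_lin _ _ _; rewrite -{1}[a *: x]addr0 ip_lin ip0l addr0.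
Qed.

Lemma ipDr x y z : ip z (x + y) = ip z x + ip z y.
Proof. by rewrite ip_conj ipDl rmorphD /= -!ip_conj. Qed.

Lemma ipZr a x z : ip z (a *: x) = a^* * ip z x.
Proof. by rewrite ip_conj ipZl rmorphM /= -!ip_conj. Qed.

Lemma ip_eq0_sym x y : ip x y = 0 -> ip y x = 0.
Proof. by rewrite (ip_conj x y) => ->; rewrite rmorph0. Qed.

Definition sqnorm x : R := complex.Re (ip x x).

Lemma sqnorm_ge0 x : 0 <= sqnorm x.
Proof. by case: ip_inner => _ _ + _; apply. Qed.

Lemma ip_sqnorm x : ip x x = (sqnorm x)%:C.
Proof.
have := ip_conj x x; rewrite /sqnorm; case: (ip x x) => a b [bNb].
by congr Complex => /=; lra.
Qed.

Lemma sqnorm0 : sqnorm 0 = 0.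
Proof. by rewrite /sqnorm ip0l. Qed.

Lemma sqnormZ (a : R[i]) x : sqnorm (a *: x) = normc a ^+ 2 * sqnorm x.
Proof.
by apply: complexI; rewrite -ip_sqnorm ipZl ipZr mulrA mulCJ ip_sqnorm -rmorphM.
Qed.

Lemma parallelogram x y :
  sqnorm (x + y) + sqnorm (x - y) = 2 * sqnorm x + 2 * sqnorm y.
Proof.
rewrite /sqnorm -scaleN1r !ipDl !ipDr !ipZl !ipZr rmorphN1.
case: (ip x x) (ip x y) (ip y x) (ip y y) => [a a'] [b b'] [c c'] [e e'] /=.
by ring.
Qed.

Lemma sqnormD_le x y : sqnorm (x + y) <= 2 * sqnorm x + 2 * sqnorm y.
Proof. by rewrite -parallelogram lerDl sqnorm_ge0. Qed.

Lemma hclosureP A x :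
  hclosure ip A x <->
  forall e : R, 0 < e -> exists2 y, A y & sqnorm (x - y) < e.
Proof.
split=> Ax e e0.
  have [|y [Ay xy]] := Ax (Num.sqrt e); first by rewrite sqrtr_gt0.
  by exists y => //; rewrite -ltr_sqrt.
have [|y Ay xy] := Ax (e ^+ 2); first by rewrite exprn_gt0.
exists y; split=> //.
by rewrite -[e]gtr0_norm // -sqrtr_sqr ltr_sqrt ?exprn_gt0.
Qed.

Lemma hclosureS A B : A `<=` B -> hclosure ip A `<=` hclosure ip B.
Proof.
move=> AB x Ax e e0; have [y [Ay xy]] := Ax e e0.
by exists y; split=> //; exact: AB.
Qed.

Lemma sub_hclosure A : A `<=` hclosure ip A.
Proof.
move=> x Ax; apply/hclosureP => e e0; exists x => //.
by rewrite subrr sqnorm0.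
Qed.

Lemma hclosure_idem A : hclosure ip (hclosure ip A) `<=` hclosure ip A.
Proof.
move=> x /hclosureP Ax; apply/hclosureP => e e0.
have [|y /hclosureP Ay xy] := Ax (e / 4); first by lra.
have [|z Az yz] := Ay (e / 4); first by lra.
exists z => //; rewrite -(subrK y x) -addrA.
by apply: le_lt_trans (sqnormD_le _ _) _; lra.
Qed.

Lemma hclosure_subspace A : is_subspace A -> is_subspace (hclosure ip A).
Proof.
move=> subA; split; first by apply: sub_hclosure; case: subA.
move=> a x y /hclosureP Ax /hclosureP Ay; apply/hclosureP => e e0.
pose t := normc a ^+ 2; have t0 : 0 <= t by exact: sqr_ge0.
have [|x' Ax' xx] := Ax (e / (4 * (t + 1))).
  by apply: divr_gt0 => //; lra.
have [|y' Ay' yy] := Ay (e / 4); first by lra.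
exists (a *: x' + y'); first by case: subA => _; apply.
rewrite opprD addrACA -scalerBr.
apply: le_lt_trans (sqnormD_le _ _) _; rewrite sqnormZ -/t.
suff : t * sqnorm (x - x') <= e / 4 by lra.
move: xx; rewrite ltr_pdivlMr; last by lra.
by have := sqnorm_ge0 (x - x'); nra.
Qed.

Lemma cspan_eq (e f : nat -> V) :
  (forall i, lspan f (e i)) -> (forall i, cspan ip e (f i)) ->
  cspan ip e = cspan ip f.
Proof.
move=> lspan_e cspan_f; apply/seteqP; split.
  apply: hclosureS; rewrite lspanE.
  apply: linspan_sub; first exact: lspan_subspace.
  by move=> _ [i _ <-]; exact: lspan_e.
apply: subset_trans (@hclosure_idem (lspan e)).
apply: hclosureS; rewrite (lspanE f); apply: linspan_sub.
  by apply: hclosure_subspace; exact: lspan_subspace.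
by move=> _ [i _ <-]; exact: cspan_f.
Qed.

Definition damped (q : R) W x y : Prop :=
  exists2 s : R[i], normc s ^+ 2 <= q & W (x - s *: y).

(* Unfolding [G m = s * G m.+1 + w] [n] times approximates [G m] by a vector of
   [W] up to a squared error of at most [q ^+ n * M]. *)
Lemma hclosure_recurrence W (G : nat -> V) (q M : R) :
  is_subspace W -> 0 <= q < 1 -> (forall m, sqnorm (G m) <= M) ->
  (forall m, damped q W (G m) (G m.+1)) ->
  forall m, hclosure ip W (G m).
Proof.
move=> subW /andP[q0 q1] G_le dampedG m; apply/hclosureP => e e0.
have approx n : exists2 y, W y & sqnorm (G m - y) <= q ^+ n * M.
  elim: n m => [|n IHn] m.
    by exists 0; [case: subW|rewrite subr0 expr0 mul1r].
  have [s s_le Ws] := dampedG m; have [y Wy yG] := IHn m.+1.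
  exists (G m - s *: G m.+1 + s *: y).
    by apply: subspaceD => //; exact: subspaceZ.
  rewrite opprD opprB addrA addrCA subrr addr0 -scalerBr sqnormZ.
  rewrite [in leRHS]exprS -mulrA.
  by rewrite ler_pM ?sqr_ge0 ?sqnorm_ge0.
have M0 : 0 <= M by apply: le_trans (G_le 0%N); exact: sqnorm_ge0.
have eM0 : 0 < e / (M + 1) by apply: divr_gt0 => //; lra.
have [n _ /(_ n (leqnn n))] : \forall n \near \oo, q ^+ n < e / (M + 1).
  by apply: (cvgr_lt 0) => //; apply: cvg_expr; rewrite ger0_norm.
rewrite ltr_pdivlMr; last by lra.
move=> qn; have [y Wy yG] := approx n; exists y => //.
apply: le_lt_trans yG _; apply: le_lt_trans qn.
by rewrite ler_wpM2l ?exprn_ge0 //; lra.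
Qed.

End InnerProduct.

Section Majorization.
Variable R : realDomainType.
Implicit Types (mu d x y : nat -> R) (i j k n p q : nat) (r : R).

Lemma exists_lt_of_sum_le x y p n i :
  (p <= i < n)%N -> y i < x i ->
  \sum_(p <= l < n) x l <= \sum_(p <= l < n) y l ->
  exists2 j, (p <= j < n)%N & x j < y j.
Proof.
move=> /andP[pi i_n] yxi sum_le; apply: contrapT => no_lt.
have yx j : (p <= j < n)%N -> y j <= x j.
  by move=> jn; rewrite leNgt; apply/negP => xyj; apply: no_lt; exists j.
suff : \sum_(p <= l < n) y l < \sum_(p <= l < n) x l by rewrite ltNge sum_le.
rewrite !(big_cat_nat pi (ltnW i_n)) /= !(big_ltn i_n) ler_ltD //.
  by apply: ler_sum_nat => l lpi; apply: yx; lia.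
by rewrite ltr_leD //; apply: ler_sum_nat => l lin; apply: yx; lia.
Qed.

Definition transfer mu j k r i : R := mu i + r *+ (i == j) - r *+ (i == k).

Lemma transferL mu j k r : j != k -> transfer mu j k r j = mu j + r.
Proof. by move=> /negbTE jk; rewrite /transfer eqxx jk subr0. Qed.

Lemma transferR mu j k r : j != k -> transfer mu j k r k = mu k - r.
Proof. by rewrite eq_sym => /negbTE kj; rewrite /transfer eqxx kj addr0. Qed.

Lemma transfer_neq mu j k r i : i != j -> i != k -> transfer mu j k r i = mu i.
Proof.
by move=> /negbTE ij /negbTE ik; rewrite /transfer ij ik addr0 subr0.
Qed.

Lemma sum_indicator r k p n :
  \sum_(p <= i < n) r *+ (i == k) = r *+ (p <= k < n)%N.
Proof.
under eq_bigr do rewrite mulrb.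
by rewrite -big_mkcond big_nat1_eq -mulrb.
Qed.

Lemma sum_transfer mu j k r p n :
  \sum_(p <= i < n) transfer mu j k r i =
  \sum_(p <= i < n) mu i + r *+ (p <= j < n)%N - r *+ (p <= k < n)%N.
Proof. by rewrite sumrB big_split /= !sum_indicator. Qed.

Definition majorized mu d p q : Prop :=
  (forall n, (n <= q)%N -> \sum_(p <= i < n) mu i <= \sum_(p <= i < n) d i) /\
  \sum_(p <= i < q) mu i = \sum_(p <= i < q) d i.

Definition mismatch mu d p q : {set 'I_q} :=
  [set i : 'I_q | (p <= i)%N && (mu i != d i)]%SET.

(* [k] is the first index with [d k < mu k]; the inequality of the partial sums
   up to [k] then forces some [j] before it. *)
Lemma majorized_gap mu d p q :
  majorized mu d p q -> (exists2 i, (p <= i < q)%N & mu i != d i) ->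
  exists j k, [/\ (p <= j < k)%N /\ (k < q)%N, mu j < d j, d k < mu k &
    forall i, (p <= i < k)%N -> mu i <= d i].
Proof.
move=> [sum_le sum_eq] [i i_in mu_d].
have above : exists k, (p <= k < q)%N && (d k < mu k).
  move: mu_d; rewrite neq_lt => /orP[mu_lt_d|d_lt_mu]; last first.
    by exists i; rewrite i_in.
  have := exists_lt_of_sum_le i_in mu_lt_d.
  by rewrite sum_eq => /(_ (lexx _))[k k_in dk]; exists k; rewrite k_in.
case: (ex_minnP above) => k /andP[k_in dk] k_min.
have [j j_in dj] : exists2 j, (p <= j < k.+1)%N & mu j < d j.
  have kS : (p <= k < k.+1)%N by lia.
  by apply: exists_lt_of_sum_le kS dk (sum_le _ _); lia.
have jk : j != k by apply: contraTneq dk => <-; rewrite -leNgt ltW.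
exists j, k; split=> //; first by lia.
move=> l lpk; rewrite leNgt; apply/negP => dl; have := k_min l; rewrite dl.
by move: lpk k_in; lia.
Qed.

Lemma mismatch_transfer mu d p q j k r :
  (p <= j < q)%N -> (p <= k < q)%N -> mu j < d j -> d k < mu k ->
  r = Num.min (d j - mu j) (mu k - d k) ->
  mismatch (transfer mu j k r) d p q \proper mismatch mu d p q.
Proof.
move=> /andP[pj jq] /andP[pk kq] dj dk rE.
have jk : j != k by apply: contraTneq dk => <-; rewrite -leNgt ltW.
apply/properP; split.
  apply/fintype.subsetP => i; rewrite !inE => /andP[-> /=].
  have [->|ij] := eqVneq (val i) j; first by rewrite (lt_eqF dj).
  have [->|ik] := eqVneq (val i) k; first by rewrite (gt_eqF dk).
  by rewrite transfer_neq.
have [djr|dkr] : r = d j - mu j \/ r = mu k - d k.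
- by rewrite rE; case: leP; [left|right].
- exists (Ordinal jq); rewrite !inE /= pj; first by rewrite (lt_eqF dj).
  by rewrite transferL // djr addrC subrK eqxx.
- exists (Ordinal kq); rewrite !inE /= pk; first by rewrite (gt_eqF dk).
  by rewrite transferR // dkr opprB addrC subrK eqxx.
Qed.

Lemma majorized_transfer mu d p q :
  {homo d : i j / (i <= j)%N >-> i <= j} -> majorized mu d p q ->
  (exists2 i, (p <= i < q)%N & mu i != d i) ->
  exists j k r, [/\ (p <= j < k)%N /\ (k < q)%N, 0 <= r <= mu k - mu j,
    majorized (transfer mu j k r) d p q &
    mismatch (transfer mu j k r) d p q \proper mismatch mu d p q].
Proof.
move=> d_le mu_maj mu_d.
have [j [k [[/andP[pj jk] kq] dj dk below]]] := majorized_gap mu_maj mu_d.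
have djk : d j <= d k by apply: d_le; exact: ltnW.
pose r := Num.min (d j - mu j) (mu k - d k).
have [r_dj r_dk] : r <= d j - mu j /\ r <= mu k - d k.
  by rewrite !ge_min !lexx orbT.
have r0 : 0 <= r by rewrite le_min !subr_ge0 !ltW.
have sum_past n : (k < n)%N ->
    \sum_(p <= i < n) transfer mu j k r i = \sum_(p <= i < n) mu i.
  move=> kn; rewrite sum_transfer.
  have [-> ->] : (p <= j < n)%N /\ (p <= k < n)%N by lia.
  by rewrite addrK.
case: mu_maj => sum_le sum_eq.
exists j, k, r; split; first by rewrite pj.
- by rewrite r0 /=; lra.
- split=> [n nq|]; last by rewrite sum_past.
  have [nk|kn] := leqP n k; last by rewrite sum_past // sum_le.
  apply: ler_sum_nat => i i_in; have [->|ij] := eqVneq i j.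
    by rewrite transferL ?ltn_eqF //; lra.
  by rewrite transfer_neq ?below //; lia.
- by apply: mismatch_transfer dj dk _ => //; lia.
Qed.

End Majorization.

Section Stages.
Variables (R : realDomainType) (d lam : nat -> R).
Implicit Types i k m n : nat.

Definition surplus n : R := \sum_(0 <= i < n) (d i - lam i).

(* The diagonal of a family in which the indices below [n] have reached their
   targets and the surplus this has cost is charged to the pivot [k]. *)
Definition staged n k i : R :=
  if (i < n)%N then d i else lam i - surplus n *+ (i == k).

Lemma sum_target n m : (n <= m)%N ->
  \sum_(n <= i < m) d i = \sum_(n <= i < m) lam i + (surplus m - surplus n).
Proof.
move=> nm; rewrite /surplus (big_cat_nat (leq0n n) nm) /= addrAC subrr add0r.
by rewrite sumrB addrCA subrr addr0.
Qed.

Lemma sum_staged n k m : (n <= k)%N ->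
  \sum_(n <= i < m) staged n k i =
  \sum_(n <= i < m) lam i - surplus n *+ (k < m)%N.
Proof.
move=> nk; have -> : (k < m)%N = (n <= k < m)%N by rewrite nk.
rewrite -sum_indicator -sumrB; apply: eq_big_nat => i /andP[ni _].
by rewrite /staged ltnNge ni.
Qed.

Lemma majorized_stage n k k' : (n <= k < k')%N ->
  (forall m, (n <= m <= k)%N -> surplus n <= surplus m) ->
  majorized (transfer (staged n k) k k' (surplus k.+1)) d n k.+1.
Proof.
move=> /andP[nk kk'] surplus_min.
have sum_stage m : (n <= m <= k.+1)%N ->
    \sum_(n <= i < m) transfer (staged n k) k k' (surplus k.+1) i =
    \sum_(n <= i < m) lam i + (surplus k.+1 - surplus n) *+ (k < m)%N.
  move=> /andP[nm mk]; rewrite sum_transfer nk /=.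
  have -> : (n <= k' < m)%N = false by lia.
  by rewrite sum_staged // subr0 mulrnBl addrAC -addrA.
split=> [m mk|]; last by rewrite sum_stage ?sum_target ?ltnSn //; lia.
have [nm|mn] := leqP n m; last by rewrite !big_geq // ltnW.
rewrite sum_stage ?nm // sum_target // lerD2l.
have [km|mk'] := ltnP k m; last by rewrite subr_ge0 surplus_min // nm.
by have -> : m = k.+1 by lia.
Qed.

Lemma transfer_stage n k k' i : (n <= k < k')%N ->
  (if (n <= i < k.+1)%N then d i
   else transfer (staged n k) k k' (surplus k.+1) i) = staged k.+1 k' i.
Proof.
move=> /andP[nk kk']; rewrite /transfer /staged ltnS.
have [ik|ki] := leqP i k.
  case: ltnP => //= i_n; have i_k : (i < k)%N by exact: leq_trans i_n nk.
  by rewrite (ltn_eqF i_k) (ltn_eqF (ltn_trans i_k kk')) subr0 addr0.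
by rewrite andbF (gtn_eqF ki) subr0 addr0 ifF //; lia.
Qed.

End Stages.

Lemma sequential_choice (T : Type) (P : nat -> T -> Prop)
    (Q : nat -> T -> T -> Prop) x0 :
  P 0%N x0 -> (forall m x, P m x -> exists2 y, P m.+1 y & Q m x y) ->
  exists X : nat -> T,
    X 0%N = x0 /\ forall m, P m (X m) /\ Q m (X m) (X m.+1).
Proof.
move=> P0 ex_next.
have [next nextP] : {next : nat * T -> T & forall y, P y.1 y.2 ->
    P y.1.+1 (next y) /\ Q y.1 y.2 (next y)}.
  apply: (choice (P := fun y z => P y.1 y.2 -> P y.1.+1 z /\ Q y.1 y.2 z)).
  move=> [m x] /=; have [/ex_next[y]|nP] := pselect (P m x); last by exists x.
  by exists y.
pose X := fix X m := if m is m'.+1 then next (m', X m') else x0.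
have PX m : P m (X m) by elim: m => // m /(nextP (m, _))[].
by exists X; split=> // m; split=> //; case: (nextP (m, X m) (PX m)).
Qed.

Lemma stabilized_limit (T : Type) (X : nat -> nat -> T) (a : nat -> nat) :
  (forall m, (a m < a m.+1)%N) ->
  (forall m i, (i < a m)%N -> X m.+1 i = X m i) ->
  exists x, forall m i, (i < a m)%N -> x i = X m i.
Proof.
move=> a_lt X_stable.
have a_le : {homo a : m n / (m <= n)%N}.
  exact: homo_leq leqnn leq_trans (fun m => ltnW (a_lt m)).
have stable m n i : (m <= n)%N -> (i < a m)%N -> X n i = X m i.
  elim: n => [|n IHn]; first by rewrite leqn0 => /eqP ->.
  rewrite leq_eqVlt ltnS => /orP[/eqP <- //|mn] im.
  by rewrite X_stable ?IHn // (leq_trans im) ?a_le.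
have le_a m : (m <= a m)%N by elim: m => // m /leq_ltn_trans; apply.
exists (fun i => X i.+1 i) => m i im.
have [mi|im'] := leqP m i.+1; first exact: stable.
by rewrite (stable i.+1 m) // ltnW.
Qed.

Lemma tail_min_of_lt_liminf (R : realType) (u : nat -> R) :
  (forall N : nat, exists k : nat, (N <= k)%N /\
     ((u k)%:E < limn_einf (fun i => (u i)%:E))%E) ->
  forall N, exists2 k, (N <= k)%N & forall i, (N <= i)%N -> u k <= u i.
Proof.
move=> below_liminf N; have [k0 [Nk0]] := below_liminf N; rewrite limn_einf_lim.
rewrite (cvg_lim (@ereal_hausdorff R) (@cvg_einfs_sup R _)).
move=> /ereal_sup_gt[_ [M _ <-] k0M].
have tail i : (M <= i)%N -> u k0 <= u i.
  move=> Mi; rewrite -lee_fin; apply: le_trans (ltW k0M) _.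
  by apply: ereal_inf_lbound; exists i.
have k0_in : (k0 - N < (M + k0).+1)%N by lia.
case: (arg_minP (fun i : 'I_(M + k0).+1 => u (N + i)%N) (P := predT)
  (i0 := Ordinal k0_in)) => // k _ k_min.
exists (N + k)%N; first exact: leq_addr.
move=> i Ni; have [i_in|Mi] := ltnP (i - N) (M + k0).+1.
  by have := k_min (Ordinal i_in) isT; rewrite /= subnKC.
apply: le_trans (tail i _); last by lia.
by have := k_min (Ordinal k0_in) isT; rewrite /= subnKC.
Qed.

Lemma sparse_tail_minima (R : realDomainType) (u w : nat -> R) :
  {homo w : i j / (i <= j)%N >-> i <= j} -> (forall M, exists i, M < w i) ->
  (forall N, exists2 k, (N <= k)%N & forall i, (N <= i)%N -> u k <= u i) ->
  exists k : nat -> nat,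
    [/\ forall m, (k m < k m.+1)%N, forall m i, (k m <= i)%N -> u (k m) <= u i &
        forall m, w (k m) + 2 * u (k m) <= w (k m.+1)].
Proof.
move=> w_le w_unb tail_min.
have ex_next p : exists q, [/\ (p < q)%N, forall i, (q <= i)%N -> u q <= u i &
    w p + 2 * u p <= w q].
  have [N Nlt] := w_unb (w p + 2 * u p).
  have [q Nq q_min] := tail_min (p.+1 + N)%N.
  exists q; split; first by lia.
  - by move=> i qi; apply: q_min; lia.
  - by apply: le_trans (ltW Nlt) _; apply: w_le; lia.
have [next nextP] := choice ex_next.
exists (fun m => iter m.+1 next 0%N); split=> m; rewrite /=.
- by case: (nextP (iter m.+1 next 0%N)).
- by case: (nextP (iter m next 0%N)).
- by case: (nextP (iter m.+1 next 0%N)).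
Qed.

Section Rotation.
Variables (R : realType) (V : lmodType R[i]) (ip : V -> V -> R[i]).
Variables (a b : R[i]) (j k : nat).
Hypothesis ip_inner : is_inner_product ip.
Hypothesis norm_ab : normc a ^+ 2 + normc b ^+ 2 = 1.
Hypothesis jk : j != k.
Implicit Types F G : nat -> V.

Definition rotate F i : V :=
  if i == j then a *: F j + b *: F k
  else if i == k then (- b)^* *: F j + a^* *: F k else F i.

Lemma rotateL F : rotate F j = a *: F j + b *: F k.
Proof. by rewrite /rotate eqxx. Qed.

Lemma rotateR F : rotate F k = (- b)^* *: F j + a^* *: F k.
Proof. by rewrite /rotate eqxx eq_sym (negbTE jk). Qed.

Lemma rotate_neq F i : i != j -> i != k -> rotate F i = F i.
Proof. by move=> /negbTE ij /negbTE ik; rewrite /rotate ij ik. Qed.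

Lemma mulCJ_sum1 : a * a^* + b * b^* = 1.
Proof. by rewrite !mulCJ -rmorphD norm_ab. Qed.

Lemma rotate_invL F : F j = a^* *: rotate F j + (- b) *: rotate F k.
Proof.
rewrite rotateL rotateR !scalerDr !scalerA addrACA -!scalerDl.
have -> : a^* * a + - b * (- b)^* = 1.
  by rewrite rmorphN mulrNN [a^* * a]mulrC mulCJ_sum1.
have -> : a^* * b + - b * a^* = 0 by rewrite mulNr [b * _]mulrC subrr.
by rewrite scale1r scale0r addr0.
Qed.

Lemma rotate_invR F : F k = b^* *: rotate F j + a *: rotate F k.
Proof.
rewrite rotateL rotateR !scalerDr !scalerA addrACA -!scalerDl.
have -> : b^* * a + a * (- b)^* = 0.
  by rewrite rmorphN mulrN [b^* * a]mulrC subrr.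
have -> : b^* * b + a * a^* = 1.
  by rewrite addrC [b^* * b]mulrC mulCJ_sum1.
by rewrite scale0r add0r scale1r.
Qed.

Lemma rotate_recombines F : recombines [set j; k] F (rotate F).
Proof.
have span_pair G (c e : R[i]) :
    linspan (G @` [set j; k]) (c *: G j + e *: G k).
  have subG := linspan_subspace (G @` [set j; k]).
  by apply: (subspaceD subG); apply: (subspaceZ _ subG);
    apply: mem_linspan_image; [left|right].
split=> [i ijk|].
  by rewrite rotate_neq //; apply: contra_notN ijk => /eqP ->; [left|right].
apply/seteqP; split; (apply: linspan_sub; first exact: linspan_subspace);
  move=> _ [_ [->|->] <-].
- by rewrite rotateL; exact: span_pair.
- by rewrite rotateR; exact: span_pair.
- by rewrite [F j]rotate_invL; exact: span_pair.
- by rewrite [F k]rotate_invR; exact: span_pair.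
Qed.

Lemma ip_pair F (p q p' q' : R[i]) : horthonormal ip F ->
  ip (p *: F j + q *: F k) (p' *: F j + q' *: F k) = p * p'^* + q * q'^*.
Proof.
move=> oF.
rewrite !(ipDl ip_inner, ipDr ip_inner, ipZl ip_inner, ipZr ip_inner).
by rewrite !oF !eqxx [k == j]eq_sym (negbTE jk) !mulr0 !mulr1 addr0 add0r.
Qed.

Lemma ip_pair_neq F (p q : R[i]) i : horthonormal ip F -> i != j -> i != k ->
  ip (p *: F j + q *: F k) (F i) = 0.
Proof.
move=> oF; rewrite ![i == _]eq_sym => /negbTE ji /negbTE ki.
by rewrite (ipDl ip_inner) !(ipZl ip_inner) !oF ji ki !mulr0 addr0.
Qed.

Lemma rotate_orthonormal F : horthonormal ip F -> horthonormal ip (rotate F).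
Proof.
move=> oF; have ip_sym0 := ip_eq0_sym ip_inner.
have kj : (k == j) = false by rewrite eq_sym (negbTE jk).
have cross : ip (rotate F j) (rotate F k) = 0.
  by rewrite rotateL rotateR ip_pair // !conjCK mulrN mulrC addNr.
have orth i : i != j -> i != k ->
    ip (rotate F j) (F i) = 0 /\ ip (rotate F k) (F i) = 0.
  by move=> ij ik; rewrite rotateL rotateR !ip_pair_neq.
move=> i l; have [->|ij] := eqVneq i j; last have [->|ik] := eqVneq i k;
  (have [->|lj] := eqVneq l j; last have [->|lk] := eqVneq l k).
- by rewrite rotateL ip_pair // mulCJ_sum1.
- exact: cross.
- by rewrite (rotate_neq F lj lk); case: (orth l).
- by rewrite kj; exact: ip_sym0.
- rewrite rotateR ip_pair // !conjCK rmorphN mulrNN addrC mulrC [b^* * b]mulrC.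
  exact: mulCJ_sum1.
- by rewrite (rotate_neq F lj lk); case: (orth l).
- by rewrite (rotate_neq F ij ik) (negbTE ij); apply: ip_sym0; case: (orth i).
- by rewrite (rotate_neq F ij ik) (negbTE ik); apply: ip_sym0; case: (orth i).
- by rewrite !rotate_neq.
Qed.

End Rotation.

Lemma orthogonal_phase (C : numClosedFieldType) (z : C) :
  exists2 w : C, `|w| = 1 & 'Re (w^* * z) = 0.
Proof.
have [->|z0] := eqVneq z 0; first by exists 1; rewrite ?normr1 ?mulr0 ?raddf0.
have norm_z : `|z| != 0 by rewrite normr_eq0.
exists ('i * z / `|z|).
  by rewrite !normrM normfV normr_id normCi mul1r divff.
have -> : ('i * z / `|z|)^* * z = - 'i * `|z|.
  rewrite !rmorphM fmorphV /= conjCi conj_normC.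
  by apply: (mulIf norm_z); rewrite -!mulrA -[`|z| * `|z|]expr2 normCK; field.
by rewrite ReMr ?normr_real // raddfN /= Re_i oppr0 mul0r.
Qed.

Lemma rotation_coefficients (R : rcfType) (z : R[i]) (t : R) : 0 <= t <= 1 ->
  exists a b : R[i],
    [/\ normc a ^+ 2 = 1 - t, normc b ^+ 2 = t & 'Re (a * b^* * z) = 0].
Proof.
move=> /andP[t0 t1]; have [w /complexI w1 wz] := orthogonal_phase z.
have sqr_normc_sqrt (s : R) : 0 <= s -> normc ((Num.sqrt s)%:C) ^+ 2 = s.
  move=> s0; rewrite /= expr0n addr0 sqrtr_sqr.
  by rewrite ger0_norm ?sqr_sqrtr ?sqrtr_ge0.
exists (Num.sqrt (1 - t))%:C, ((Num.sqrt t)%:C * w); split.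
- by rewrite sqr_normc_sqrt ?subr_ge0.
- by rewrite normcM w1 mulr1 sqr_normc_sqrt.
rewrite [(_ * w)^*]rmorphM /= conj_realC mulrA -rmorphM -mulrA.
by rewrite ReMl ?wz ?mulr0 //; apply/complex_realP; eexists.
Qed.

Section SymmetricOperator.
Variables (R : realType) (V : lmodType R[i]) (ip : V -> V -> R[i]).
Variables (D : set V) (E : V -> V).
Hypothesis ip_inner : is_inner_product ip.
Hypothesis subD : is_subspace D.
Hypothesis symE : hsymmetric_op ip D E.
Implicit Types (mu d : nat -> R) (F G : nat -> V) (i j k n p q : nat).

Lemma op_lincomb (a b : R[i]) x y : D x -> D y ->
  E (a *: x + b *: y) = a *: E x + b *: E y.
Proof.
case: symE subD => E_lin _ [D0 D_lin] Dx Dy.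
have E0 : E 0 = 0.
  have := E_lin 1 0 0 D0 D0.
  by rewrite scale1r addr0 scale1r -{1}[E 0]addr0 => /addrI.
have EZ : E (b *: y) = b *: E y by rewrite -{1}[b *: y]addr0 E_lin // E0 addr0.
by rewrite E_lin ?EZ //; exact: subspaceZ.
Qed.

Lemma diag_lincomb (a b : R[i]) x y : D x -> D y ->
  ip (E (a *: x + b *: y)) (a *: x + b *: y) =
  a * a^* * ip (E x) x + b * b^* * ip (E y) y +
  2 * 'Re (a * b^* * ip (E x) y).
Proof.
move=> Dx Dy; rewrite op_lincomb //.
rewrite !(ipDl ip_inner, ipDr ip_inner, ipZl ip_inner, ipZr ip_inner).
have E_conj : ip (E y) x = (ip (E x) y)^*.
  by case: symE => _ E_sym; rewrite E_sym // (ip_conj ip_inner).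
by rewrite ReE [2 * _]mulrC divfK ?pnatr_eq0 // E_conj !rmorphM /= conjCK; ring.
Qed.

Definition orthonormal_diag F mu : Prop :=
  [/\ forall i, D (F i), horthonormal ip F &
      forall i, ip (E (F i)) (F i) = (mu i)%:C].

Lemma eq_orthonormal_diag F mu mu' :
  mu =1 mu' -> orthonormal_diag F mu -> orthonormal_diag F mu'.
Proof. by move=> mu_eq [DF oF EF]; split=> // i; rewrite EF mu_eq. Qed.

Lemma rotate_diag (a b : R[i]) j k F mu (t : R) : j != k ->
  normc a ^+ 2 = 1 - t -> normc b ^+ 2 = t ->
  'Re (a * b^* * ip (E (F j)) (F k)) = 0 -> orthonormal_diag F mu ->
  orthonormal_diag (rotate a b j k F) (transfer mu j k (t * (mu k - mu j))).
Proof.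
move=> jk norm_a norm_b cross0 [DF oF EF].
have norm_ab : normc a ^+ 2 + normc b ^+ 2 = 1 by rewrite norm_a norm_b subrK.
have D_comb (c e : R[i]) : D (c *: F j + e *: F k).
  by apply: (subspaceD subD); exact: subspaceZ.
split=> [i||i]; [|exact: rotate_orthonormal|].
- have [->|ij] := eqVneq i j; first by rewrite rotateL.
  have [->|ik] := eqVneq i k; first by rewrite rotateR.
  by rewrite rotate_neq.
- have [->|ij] := eqVneq i j.
    rewrite rotateL diag_lincomb // cross0 mulr0 addr0 !EF !mulCJ norm_a norm_b.
    by rewrite transferL // -!rmorphM -rmorphD /=; congr _%:C; ring.
  have [->|ik] := eqVneq i k; last by rewrite rotate_neq // transfer_neq.
  have crossR : 'Re ((- b)^* * (a^*)^* * ip (E (F j)) (F k)) = 0.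
    by rewrite conjCK rmorphN /= !mulNr raddfN /= [b^* * a]mulrC cross0 oppr0.
  rewrite rotateR // diag_lincomb // crossR mulr0 addr0 !EF !conjCK.
  rewrite rmorphN /= mulrNN ![_^* * _]mulrC !mulCJ norm_a norm_b transferR //.
  by rewrite -!rmorphM -rmorphD /=; congr _%:C; ring.
Qed.

Lemma transfer_rotation F mu j k (r q : R) :
  orthonormal_diag F mu -> j != k -> 0 <= q <= 1 ->
  0 <= r <= q * (mu k - mu j) ->
  exists G, [/\ orthonormal_diag G (transfer mu j k r),
    recombines [set j; k] F G &
    damped q (linspan [set G j]) (F j) (G k)].
Proof.
move=> F_diag jk /andP[q0 q1] /andP[r0 rq].
have [t /andP[t0 tq] tr] : exists2 t, 0 <= t <= q & t * (mu k - mu j) = r.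
  have [mu_le|mu_lt] := leP (mu k - mu j) 0.
    exists 0; first by rewrite lexx.
    by rewrite mul0r; apply/eqP; rewrite eq_le r0 /=; nra.
  exists (r / (mu k - mu j)); last by rewrite divfK // gt_eqF.
  by rewrite divr_ge0 ?(ltW mu_lt) //= ler_pdivrMr.
have t1 : 0 <= t <= 1 by rewrite t0 (le_trans tq).
have [a [b [norm_a norm_b cross0]]] :=
  rotation_coefficients (ip (E (F j)) (F k)) t1.
have norm_ab : normc a ^+ 2 + normc b ^+ 2 = 1 by rewrite norm_a norm_b subrK.
exists (rotate a b j k F); split.
- by rewrite -tr; exact: rotate_diag.
- exact: rotate_recombines.
- exists (- b); first by rewrite normcN norm_b.
  rewrite [F j](rotate_invL norm_ab jk) addrK.
  by apply: (subspaceZ _ (linspan_subspace _)); exact: sub_linspan.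
Qed.

Lemma schur_horn_interval F mu d p q :
  {homo d : i j / (i <= j)%N >-> i <= j} -> orthonormal_diag F mu ->
  majorized mu d p q ->
  exists2 G,
    orthonormal_diag G (fun i => if (p <= i < q)%N then d i else mu i) &
    recombines [set i | (p <= i < q)%N] F G.
Proof.
move=> d_le; have [n] := ubnP #|mismatch mu d p q|.
elim: n F mu => // n IHn F mu; rewrite ltnS => mismatch_le F_diag mu_maj.
have [mu_d|all_eq] := pselect (exists2 i, (p <= i < q)%N & mu i != d i);
  last first.
  exists F; last exact: recombines_refl.
  apply: eq_orthonormal_diag F_diag => i; case: ifP => // i_in.
  by apply/eqP; apply: contrapT => /negP mu_d; apply: all_eq; exists i.
have [j [k [r [[jk kq] r_in transfer_maj mismatch_lt]]]] :=
  majorized_transfer d_le mu_maj mu_d.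
have j_neq_k : j != k by lia.
have one_in : 0 <= (1 : R) <= 1 by rewrite ler01 lexx.
rewrite -[mu k - mu j]mul1r in r_in.
have [H [H_diag FH _]] := transfer_rotation F_diag j_neq_k one_in r_in.
have [|G G_diag HG] := IHn _ _ _ H_diag transfer_maj.
  by apply: leq_trans mismatch_le; exact: proper_card.
exists G.
  apply: eq_orthonormal_diag G_diag => i; case: ifP => // i_out.
  by rewrite transfer_neq //; apply: contraFneq i_out => ->; lia.
apply: recombines_trans HG; apply: recombinesS FH => i [->|->] /=; lia.
Qed.

Lemma stage_step d lam F n k k' :
  {homo d : i j / (i <= j)%N >-> i <= j} -> (n <= k < k')%N ->
  (forall m, (n <= m <= k)%N -> surplus d lam n <= surplus d lam m) ->
  0 <= surplus d lam k.+1 ->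
  lam k + 2 * surplus d lam k.+1 <= lam k' + surplus d lam n ->
  orthonormal_diag F (staged d lam n k) ->
  exists G, [/\ orthonormal_diag G (staged d lam k.+1 k'),
    recombines ([set i | (n <= i < k.+1)%N] `|` [set k']) F G &
    damped 2^-1 (linspan (G @` [set i | (n <= i < k.+1)%N])) (F k) (G k')].
Proof.
set B := [set i | _]; move=> d_le nkk' surplus_min surplus_ge0 gap F_diag.
have [nk kk'] := andP nkk'.
have Bk : B k by rewrite /B /= nk ltnSn.
have k_neq_k' : k != k' by rewrite ltn_eqF.
have half_in : 0 <= (2^-1 : R) <= 1 by rewrite invr_ge0 ler0n invf_le1 ?ler1n.
have surplus_in : 0 <= surplus d lam k.+1 <=
    2^-1 * (staged d lam n k k' - staged d lam n k k).
  rewrite surplus_ge0 /staged !ltnNge nk (leq_trans nk (ltnW kk')) /=.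
  by rewrite eqxx [k' == k]eq_sym (negbTE k_neq_k') mulr0n mulr1n; lra.
have [H [H_diag FH [s s_le FkH]]] :=
  transfer_rotation F_diag k_neq_k' half_in surplus_in.
have [G G_diag HG] :=
  schur_horn_interval d_le H_diag (majorized_stage nkk' surplus_min).
exists G; split.
- by apply: eq_orthonormal_diag G_diag => i; exact: transfer_stage.
- apply: recombines_trans (recombinesS _ HG); last by move=> i Bi; left.
  by apply: recombinesS FH => i [->|->]; [left|right].
- case: HG => offB spanB; exists s => //.
  have -> : G k' = H k' by apply: offB; rewrite /B /=; lia.
  rewrite spanB; apply: linspan_sub FkH; first exact: linspan_subspace.
  by move=> _ ->; exact: mem_linspan_image.
Qed.

Section Pivots.
Variables (d lam : nat -> R) (f : nat -> V) (k : nat -> nat).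
Hypothesis k_lt : forall m, (k m < k m.+1)%N.

Definition block_start m : nat := if m is m'.+1 then (k m').+1 else 0.

Definition reached m : set nat := `I_(block_start m) `|` [set k m].

Lemma block_start_le m : (block_start m <= k m)%N.
Proof. by case: m => // m; exact: k_lt. Qed.

Lemma block_start_lt m : (block_start m < block_start m.+1)%N.
Proof. by rewrite ltnS; exact: block_start_le. Qed.

Lemma ltn_block_start i : (i < block_start i.+1)%N.
Proof. by elim: i => // i IHi; apply: leq_ltn_trans IHi (block_start_lt _). Qed.

Lemma cspan_limit e (F : nat -> nat -> V) :
  (forall m, horthonormal ip (F m)) ->
  (forall m, recombines (reached m) f (F m)) ->
  (forall m i, (i < block_start m)%N -> e i = F m i) ->
  (forall m, damped 2^-1 (linspan (F m.+1 @` `I_(block_start m.+1)))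
     (F m (k m)) (F m.+1 (k m.+1))) ->
  forall i, cspan ip e (f i).
Proof.
move=> oF fF eF pivots_damped.
have settled m i : (i < block_start m)%N -> lspan e (F m i).
  by move=> im; rewrite -(eF m) //; exact: mem_lspan.
have cspan_pivot : forall m, cspan ip e (F m (k m)).
  apply: (hclosure_recurrence (q := 2^-1) (M := 1) ip_inner).
  - exact: lspan_subspace.
  - by rewrite invr_ge0 ler0n invf_lt1 ?ltr1n.
  - by move=> m; rewrite /sqnorm oF eqxx.
  - move=> m; have [s s_le pivot_lspan] := pivots_damped m; exists s => //.
    apply: linspan_sub pivot_lspan; first exact: lspan_subspace.
    by move=> _ [i im <-]; exact: settled.
have cspan_e_sub : is_subspace (cspan ip e).
  by apply: (hclosure_subspace ip_inner); exact: lspan_subspace.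
move=> i; have : linspan (F i.+1 @` reached i.+1) (f i).
  have [_ ->] := fF i.+1; apply: mem_linspan_image; left.
  exact: ltn_block_start.
apply: linspan_sub => // _ [l [lm|->] <-]; last exact: cspan_pivot.
by apply: (sub_hclosure ip_inner); exact: settled.
Qed.

Hypothesis d_le : {homo d : i j / (i <= j)%N >-> i <= j}.
Hypothesis surplus_min : forall m i, (block_start m <= i)%N ->
  surplus d lam (block_start m) <= surplus d lam i.
Hypothesis gap :
  forall m, lam (k m) + 2 * surplus d lam (k m).+1 <= lam (k m.+1).
Hypothesis f_diag : orthonormal_diag f lam.

Lemma stage_sequence : exists F : nat -> nat -> V, forall m,
  [/\ orthonormal_diag (F m) (staged d lam (block_start m) (k m)),
      recombines (reached m) f (F m),
      forall i, (i < block_start m)%N -> F m.+1 i = F m i &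
      damped 2^-1 (linspan (F m.+1 @` `I_(block_start m.+1)))
        (F m (k m)) (F m.+1 (k m.+1))].
Proof.
have surplus0 : surplus d lam 0 = 0 by rewrite /surplus big_geq.
have surplus_ge0 m : 0 <= surplus d lam m.
  by rewrite -surplus0 (surplus_min (m := 0)).
pose P m G := orthonormal_diag G (staged d lam (block_start m) (k m)) /\
  recombines (reached m) f G.
pose Q m G H := (forall i, (i < block_start m)%N -> H i = G i) /\
  damped 2^-1 (linspan (H @` `I_(block_start m.+1))) (G (k m)) (H (k m.+1)).
have P0 : P 0%N f.
  split; last exact: recombines_refl.
  apply: eq_orthonormal_diag f_diag => i.
  by rewrite /staged surplus0 mul0rn subr0.
have next m G : P m G -> exists2 H, P m.+1 H & Q m G H.
  move=> [G_diag fG]; have start_le := block_start_le m.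
  have [||||H [H_diag GH [s s_le pivot_span]]] :=
    stage_step (k' := k m.+1) d_le _ _ _ _ G_diag.
  - by rewrite start_le k_lt.
  - by move=> i /andP[mi _]; exact: surplus_min.
  - exact: surplus_ge0.
  - by have := gap m; have := surplus_ge0 (block_start m); lra.
  exists H; split=> //.
  - apply: recombines_trans (recombinesS _ fG) (recombinesS _ GH) => i.
      by case=> [/= im|->]; left => /=; lia.
    by case=> [/andP[]|->]; [left|right].
  - move=> i im; case: GH => + _; apply; case=> [/=|/= ik]; first by lia.
    by have := k_lt m; lia.
  - exists s => //; apply: linspanS pivot_span.
    by apply: image_subset => i /andP[].
have [F [_ FP]] := sequential_choice P0 next.
by exists F => m; have [[? ?] [? ?]] := FP m.
Qed.

Lemma schur_horn_of_pivots : exists e : nat -> V,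
  [/\ horthonormal ip e, forall i, lspan f (e i), cspan ip e = cspan ip f &
      forall i, ip (E (e i)) (e i) = (d i)%:C].
Proof.
have [F FP] := stage_sequence.
have F_stable m i : (i < block_start m)%N -> F m.+1 i = F m i.
  by case: (FP m) => _ _ + _; apply.
have [e eF] := stabilized_limit block_start_lt F_stable.
have lspan_e i : lspan f (e i).
  have [_ fF _ _] := FP i.+1.
  rewrite (eF i.+1) ?ltn_block_start // lspanE.
  have [_ <-] := recombinesS (@subsetT _ _) fF.
  by apply: sub_linspan; exists i.
exists e; split=> //.
- move=> i j; pose m := (maxn i j).+1.
  have lt_start l : (l <= maxn i j)%N -> (l < block_start m)%N.
    by move=> l_le; apply: leq_ltn_trans l_le (ltn_block_start _).
  rewrite !(eF m) ?lt_start ?leq_maxl ?leq_maxr //.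
  by case: (FP m) => -[_ oF _] _ _ _.
- apply: (cspan_eq ip_inner) => //; apply: (cspan_limit (F := F)) eF _.
  + by move=> m; case: (FP m) => -[].
  + by move=> m; case: (FP m).
  + by move=> m; case: (FP m).
- move=> i; have [[_ _ EF] _ _ _] := FP i.+1.
  by rewrite (eF i.+1) ?ltn_block_start // EF /staged ltn_block_start.
Qed.

End Pivots.

End SymmetricOperator.

Theorem theorem4p3 (R : realType) (V : lmodType R[i]) (ip : V -> V -> R[i])
  (D : set V) (E : V -> V) (d lam : nat -> R) (f : nat -> V) :
  is_hilbert ip ->
  is_subspace D -> hdense ip D ->
  hsymmetric_op ip D E ->
  nondecr_seq d -> unbounded_seq d ->
  nondecr_seq lam -> unbounded_seq lam ->
  (forall k : nat, 0 <= delta d lam k) ->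
  (forall N : nat, exists k : nat, (N <= k)%N /\
     ((delta d lam k)%:E < limn_einf (fun i => (delta d lam i)%:E))%E) ->
  (forall i : nat, D (f i)) ->
  horthonormal ip f ->
  (forall i : nat, ip (E (f i)) (f i) = ((lam i)%:C)%C) ->
  exists e : nat -> V,
    [/\ horthonormal ip e,
        (forall i : nat, lspan f (e i)),
        cspan ip e = cspan ip f &
        (forall i : nat, ip (E (e i)) (e i) = ((d i)%:C)%C)].
Proof.
move=> [ip_inner _] subD _ symE d_le _ lam_le lam_unb delta_ge0 delta_lt Df.
move=> f_orthonormal Ef; have surplusS n : surplus d lam n.+1 = delta d lam n.
  by rewrite /surplus big_mkord.
have surplus0 : surplus d lam 0 = 0 by rewrite /surplus big_geq.
have [k [k_lt k_min gap]] :=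
  sparse_tail_minima lam_le lam_unb (tail_min_of_lt_liminf delta_lt).
apply: (schur_horn_of_pivots ip_inner subD symE k_lt d_le) => //.
- move=> [|m] [|i] //= mi; rewrite ?surplus0 !surplusS ?delta_ge0 //.
  exact: k_min.
- by move=> m; rewrite surplusS.
Qed.
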